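(* Let $A\in\mathbb{C}^{n\times n}$ be normal, and let $\widetilde{A}=A+E$, where $E\in\mathbb{C}^{n\times n}$ is an arbitrary perturbation. Suppose that $\widetilde{U}_1\in\mathbb{C}^{n\times n}$ is unitary and $$\widetilde{A}=\widetilde{U}_1\,\mathrm{diag}\big(\widetilde{A}_1,\ldots,\widetilde{A}_s\big)\,\widetilde{U}_1^{\ast}$$ for some positive integer $s$, where each $\widetilde{A}_i\in\mathbb{C}^{n_i\times n_i}$ is upper triangular and $\sum_{i=1}^{s}n_i=n$. Let $\Delta_1=\mathcal{U}(\widetilde{U}_1^{\ast}\widetilde{A}\widetilde{U}_1)$. Assume that the spectra of $A$ and $\widetilde{A}$ are $\{\lambda_i\}_{i=1}^n$ and $\{\widetilde{\lambda}_i\}_{i=1}^n$, respectively. Then there exists a permutation $\pi$ of $\{1,\ldots,n\}$ such that, with $\mathbb{D}_2=\big(\sum_{i=1}^{n}|\widetilde{\lambda}_{\pi(i)}-\lambda_i|^2\big)^{1/2}$, all of the following hold: \begin{align*} \mathbb{D}_{2}&\leq\sqrt{\|E\|_{F}^{2}+(n-s)\delta(E)^{2}},\\ \mathbb{D}_{2}&\leq\sqrt{\|E\|_{F}^{2}+\sqrt{n-s+1}\,\delta(E)\|\Delta_{1}\|_{F}},\\ \mathbb{D}_{2}&\leq\sqrt{\|E\|_{F}^{2}+2\sqrt{n-s}\,\delta(E)\|\Delta_{1}\|_{F}-\|\Delta_{1}\|_{F}^{2}}. \end{align*}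
   Context: Spectra are listed with algebraic multiplicity. The block sizes $n_i$ are positive integers and $\mathrm{diag}(\widetilde{A}_1,\ldots,\widetilde{A}_s)$ is the block diagonal matrix with the indicated blocks. $\|\cdot\|_F$ is the Frobenius norm, $X^{\ast}$ is the conjugate transpose, and $\mathrm{tr}$ is the trace. A matrix $A$ is normal if $AA^{\ast}=A^{\ast}A$. For $M\in\mathbb{C}^{n\times n}$, $\mathcal{U}(M)$ denotes the strictly upper triangular part of $M$ (entries with $i<j$ kept, all others set to $0$), and $\delta(M):=\big(\|M\|_F^2-\frac1n|\mathrm{tr}(M)|^2\big)^{1/2}$ (the quantity in parentheses is always nonnegative). *)

(* Defs.v *)
From mathcomp Require Import all_boot all_order all_algebra.
From mathcomp Require Import perm reals.
From mathcomp Require Import complex.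

Set Implicit Arguments.
Unset Strict Implicit.
Unset Printing Implicit Defensive.

Import GRing.Theory Num.Theory.
Local Open Scope ring_scope.

(* Norms are valued in C itself, following `| _ | : C -> C. The order on a
   numClosedFieldType makes [x <= y] hold exactly when y - x is real and
   nonnegative, and [sqrtC] of a negative number is purely imaginary; hence
   [d <= sqrtC r] with d and r real and d >= 0 asserts in particular
   that r >= 0. *)
Section MatrixQuantities.
Variable C : numClosedFieldType.

Definition fronorm (m n : nat) (M : 'M[C]_(m, n)) : C :=
  sqrtC (\sum_(i < m) \sum_(j < n) `|M i j| ^+ 2).

Definition delta (n : nat) (M : 'M[C]_n) : C :=
  sqrtC (fronorm M ^+ 2 - n%:R^-1 * `|\tr M| ^+ 2).

(* The library's [is_trig_mx] means lower triangular. *)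
Definition upper_triangular (n : nat) (M : 'M[C]_n) : Prop :=
  forall i j : 'I_n, (j < i)%N -> M i j = 0.

Definition strict_upper (n : nat) (M : 'M[C]_n) : 'M[C]_n :=
  \matrix_(i, j) (if (i < j)%N then M i j else 0).

Definition has_spectrum (n : nat) (M : 'M[C]_n) (lam : 'I_n -> C) : Prop :=
  char_poly M = \prod_(i < n) ('X - (lam i)%:P).

Definition eig_dist (n : nat) (lamt lam : 'I_n -> C) (pi : 'S_n) : C :=
  sqrtC (\sum_(i < n) `|lamt (pi i) - lam i| ^+ 2).

End MatrixQuantities.

(* Main.v *)
Require Import Defs.
From mathcomp Require Import all_boot all_order all_algebra.
From mathcomp Require Import perm reals.
From mathcomp Require Import complex.
From mathcomp Require Import ring.

Set Implicit Arguments.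
Unset Strict Implicit.
Unset Printing Implicit Defensive.

Import Order.POrderTheory GRing.Theory Num.Theory.
Local Open Scope ring_scope.
Local Open Scope sesquilinear_scope.

(** Conjugating by U reduces everything to a normal matrix A and an upper
    triangular T = A + E whose entries vanish outside s diagonal blocks; the
    strictly upper part Delta of T is then carried by the set P of pairs i < j
    lying in a common block.

    The diagonal D of T is normal and has the spectrum of T, so the
    Hoffman-Wielandt theorem gives one permutation with
    D2^2 <= |A - D|_F^2.  Write X_P for the part of X carried by P.  Comparing
    entries, with A - T = -E, turns the right-hand side into
    |E|_F^2 + |A_P|_F^2 - |E_P|_F^2 ([sqr_fronorm_diag_dist]), and
    Delta = A_P + E_P.

    It remains to bound A_P, and this is where normality of A enters.  Row i
    and column i of a normal matrix have the same norm; adding this up over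
    i < k, the parts of A above and below each cut k of the index set have the
    same norm ([normalmx_cut]).  A pair in P is separated by a cut interior to
    a block, and there are at most n - s of these, so |A_P|_F^2 is at most
    n - s times the squared norm of the strictly lower part of A
    ([normalmx_same_block_upper_le]).  That lower part is the opposite of the
    one of E, and together with E_P it has squared norm at most delta(E)^2
    ([sqr_delta_ge]).  The three bounds follow from these inequalities and
    from the triangle inequality between A_P, E_P and Delta
    ([sqr_diff_le_sqr], [sqr_diff_le_cross], [sqr_diff_le_completed]).

    For Hoffman-Wielandt, diagonalizing A and B expresses |A - B|_F^2 as
    the average of the costs |b_j - a_i|^2 against a doubly stochastic matrix,
    so an optimal assignment must cost at most that average
    ([assignment_le_doubly_stochastic]).  Instead of decomposing the doubly
    stochastic matrix into permutations, the proof uses linear programming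
    duality: optimality of a permutation forbids cycles of negative cost,
    and shortest walks then provide a dual solution certifying the bound. *)

(** * Assignments and doubly stochastic matrices *)

Section Assignment.
Variables (R : numDomainType) (T : finType).
Implicit Types (x y i j : T) (p q : seq T).

(** The walk starts at [x] and then visits [p]; closed walks are written
    [rcons p x]. *)
Fixpoint walk_cost (w : T -> T -> R) x p : R :=
  if p is y :: q then w x y + walk_cost w y q else 0.

Lemma walk_cost_cat w x p q :
  walk_cost w x (p ++ q) = walk_cost w x p + walk_cost w (last x p) q.
Proof. by elim: p x => [|y p IH] x /=; rewrite ?add0r // IH addrA. Qed.

Lemma walk_cost_real w x p :
  (forall i j, w i j \is Num.real) -> walk_cost w x p \is Num.real.
Proof.
move=> wR; elim: p x => [|y p IH] x /=; first exact: rpred0.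
by apply: realD; [exact: wR | exact: IH].
Qed.

Lemma sum_next_walk_cost w x p : uniq (x :: p) ->
  \sum_(i <- x :: p) w i (next (x :: p) i) = walk_cost w x (rcons p x).
Proof.
(* The vertex at which [next] wraps around must stay fixed in the induction. *)
rewrite /=; move: {3 6}x => x0.
elim: p x => [|y p IH] x; first by rewrite big_seq1 /= eqxx addr0.
move=> /= /and3P[xyp yp up].
rewrite big_cons eqxx -IH /= ?yp ?up //; congr (_ + _).
apply: eq_big_seq => i iyp; case: eqP => // xi.
by rewrite -xi iyp in xyp.
Qed.

(** The vertices outside the cycle are fixed by [next], so a cycle can be costed
    as a permutation of the whole vertex set. *)
Lemma sum_next_cycle w x p : uniq (x :: p) -> (forall i, w i i = 0) ->
  \sum_i w i (next (x :: p) i) = walk_cost w x (rcons p x).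
Proof.
move=> Up w0; rewrite -(sum_next_walk_cost w Up) [RHS]big_uniq //.
rewrite [LHS](bigID [in x :: p]) /= [X in _ + X]big1 ?addr0 // => i.
by rewrite -[next_at i x x p]/(next (x :: p) i) next_nth => /negPf ->.
Qed.

(** The potential of [i] is the least cost of a simple walk starting at [i].
    Prepending an arc to the best walk from [j] either gives a simple walk from
    [i], or closes a cycle, whose removal does not increase the cost. *)
Lemma cycle_free_potential w : (forall i j, w i j \is Num.real) ->
  (forall x p, uniq (x :: p) -> 0 <= walk_cost w x (rcons p x)) ->
  exists u : T -> R,
    (forall i, u i \is Num.real) /\ forall i j, u i <= w i j + u j.
Proof.
move=> wR wcyc.
pose best i := [arg min_(p < [bseq] : #|T|.-bseq T | uniq (i :: p))
                  walk_cost w i p]%O.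
have bestP i : uniq (i :: best i) /\
    forall q, uniq (i :: q) -> walk_cost w i (best i) <= walk_cost w i q.
  rewrite /best; case: real_arg_minP => // [p _|p Up pmin].
    exact: walk_cost_real.
  split=> // q Uq; have szq: (size q <= #|T|)%N.
    by move: Uq => /= /andP[_ /card_uniqP <-]; apply: max_card.
  exact: (pmin (Bseq szq)).
exists (fun i => walk_cost w i (best i)); split=> [i|i j].
  exact: walk_cost_real.
have [Uj _] := bestP j; have [_ imin] := bestP i.
have [ij|ij] := boolP (i \in j :: best j); last first.
  by apply: (imin (j :: best j)); rewrite /= ij.
case/splitPl: ij Uj => p1 p2 lp1.
rewrite -cat_cons cat_uniq walk_cost_cat lp1 => /and3P[U1 /hasPn H12 U2].
rewrite addrA; apply: (@le_trans _ _ (walk_cost w i p2)).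
  apply: imin; rewrite /= U2 andbT; apply/negP => /H12 /=.
  by rewrite -lp1 mem_last.
(* What is removed is the closed walk i, j, p1, where p1 ends at i. *)
rewrite lerDr; case/lastP: p1 => [|q k] in lp1 U1 H12 *.
  by move: lp1 => /= ->; apply: (wcyc i [::]).
move: lp1 U1; rewrite last_rcons => <-; rewrite -rcons_cons rcons_uniq => U1.
exact: (wcyc k (j :: q)).
Qed.

(** Let s be a cheapest permutation.  Rerouting s along a cycle cannot make it
    cheaper, so the reduced costs [c i (s j) - c i (s i)] have no negative cycle
    and admit a potential u.  Averaging
    [c i (s i) + u i - u j <= c i (s j)] against W makes u cancel out, since
    all the row and column sums are 1. *)
Lemma assignment_le_doubly_stochastic (c W : T -> T -> R) :
  (forall i j, c i j \is Num.real) -> (forall i j, 0 <= W i j) ->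
  (forall i, \sum_j W i j = 1) -> (forall j, \sum_i W i j = 1) ->
  exists s : {perm T}, \sum_i c i (s i) <= \sum_i \sum_j W i j * c i j.
Proof.
move=> cR W0 Wr Wc.
pose s := [arg min_(s < 1%g : {perm T}) \sum_i c i (s i)]%O.
have smin t : \sum_i c i (s i) <= \sum_i c i ((t : {perm T}) i).
  rewrite /s; case: real_arg_minP => // [t' _|t' _ tmin]; last exact: tmin.
  by apply: rpred_sum => i _.
exists s; pose w i j := c i (s j) - c i (s i).
have [||u [uR wu]] := @cycle_free_potential w.
- by move=> i j; apply: rpredB.
- move=> x p Up; rewrite -(sum_next_cycle Up) => [|i]; last by rewrite /w subrr.
  rewrite /w sumrB subr_ge0.
  have := smin (perm (can_inj (prev_next Up)) * s)%g.
  by under [X in _ <= X -> _]eq_bigr do rewrite permM permE.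
have Ws i : \sum_j W i (s j) = 1.
  by rewrite -(Wr i) [RHS](reindex_inj (@perm_inj _ s)).
have -> : \sum_i c i (s i) =
    \sum_i \sum_j W i (s j) * (c i (s i) + u i - u j).
  transitivity (\sum_i (c i (s i) + u i) - \sum_j u j).
    by rewrite big_split /= addrK.
  rewrite [RHS](eq_bigr (fun i =>
    \sum_j W i (s j) * (c i (s i) + u i) - \sum_j W i (s j) * u j)).
    rewrite sumrB; congr (_ - _).
      by apply: eq_bigr => i _; rewrite -mulr_suml Ws mul1r.
    by rewrite [RHS]exchange_big; apply: eq_bigr => j _; rewrite -mulr_suml Wc mul1r.
  by move=> i _; rewrite -sumrB; apply: eq_bigr => j _; rewrite mulrBr.
apply: ler_sum => i _; rewrite [X in _ <= X](reindex_inj (@perm_inj _ s)) /=.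
apply: ler_sum => j _; apply: ler_wpM2l => //.
by rewrite lerBlDr -lerBrDl addrAC; apply: wu.
Qed.
End Assignment.

(** * Frobenius norm, spectra and the Hoffman-Wielandt theorem *)

Section HoffmanWielandt.
Variable C : numClosedFieldType.

Lemma fronorm_ge0 m n (M : 'M[C]_(m, n)) : 0 <= fronorm M.
Proof.
rewrite sqrtC_ge0; apply: sumr_ge0 => i _; apply: sumr_ge0 => j _.
exact: exprn_ge0.
Qed.

Lemma sqr_fronorm m n (M : 'M[C]_(m, n)) :
  fronorm M ^+ 2 = \sum_i \sum_j `|M i j| ^+ 2.
Proof. exact: sqrtCK. Qed.

Lemma sqr_fronorm_trace m n (M : 'M[C]_(m, n)) :
  fronorm M ^+ 2 = \tr (M *m M ^t*).
Proof.
rewrite sqr_fronorm; apply: eq_bigr => i _; rewrite mxE.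
by apply: eq_bigr => j _; rewrite !mxE normCK.
Qed.

Lemma fronorm_trmxC m n (M : 'M[C]_(m, n)) : fronorm (M ^t*) = fronorm M.
Proof.
rewrite /fronorm exchange_big; congr sqrtC.
by apply: eq_bigr => i _; apply: eq_bigr => j _; rewrite !mxE norm_conjC.
Qed.

Lemma fronorm_mulmx_unitary m n (M : 'M[C]_(m, n)) (U : 'M[C]_n) :
  U \is unitarymx -> fronorm (M *m U) = fronorm M.
Proof.
move=> UU; apply/eqP; rewrite -(eqrXn2 (n := 2)) ?fronorm_ge0 //.
by rewrite !sqr_fronorm_trace trmx_mul map_mxM mulmxA mulmxtVK.
Qed.

Lemma fronorm_mul_unitarymx m n (M : 'M[C]_(m, n)) (U : 'M[C]_m) :
  U \is unitarymx -> fronorm (U *m M) = fronorm M.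
Proof.
move=> UU; rewrite -fronorm_trmxC trmx_mul map_mxM fronorm_mulmx_unitary.
  exact: fronorm_trmxC.
by rewrite trmxC_unitary.
Qed.

Lemma char_poly_conj n (M P Q : 'M[C]_n) : P *m Q = 1%:M ->
  char_poly (P *m M *m Q) = char_poly M.
Proof.
move=> PQ; rewrite /char_poly.
have QP := mulmx1C PQ.
have -> : char_poly_mx (P *m M *m Q) =
    map_mx polyC P *m char_poly_mx M *m map_mx polyC Q.
  rewrite /char_poly_mx mulmxBr mulmxBl -!map_mxM; congr (_ - _).
  by rewrite mul_mx_scalar -scalemxAl -map_mxM PQ map_mx1 scalemx1.
rewrite !det_mulmx mulrAC -det_mulmx -map_mxM PQ map_mx1 det1 mul1r //.
Qed.

Lemma char_poly_upper_triangular n (M : 'M[C]_n) :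
  upper_triangular M -> char_poly M = \prod_(i < n) ('X - (M i i)%:P).
Proof.
move=> Mup; have : is_trig_mx M^T.
  by apply/is_trig_mxP => i j ij; rewrite mxE Mup.
move/char_poly_trig; rewrite /char_poly.
have -> : char_poly_mx M^T = (char_poly_mx M)^T.
  by rewrite /char_poly_mx linearB /= tr_scalar_mx map_trmx.
by rewrite det_tr => ->; apply: eq_bigr => i _; rewrite mxE.
Qed.

(** Unique factorization of the characteristic polynomial. *)
Lemma has_spectrum_perm n (M : 'M[C]_n) (lam mu : 'I_n -> C) :
  has_spectrum M lam -> has_spectrum M mu ->
  exists s : 'S_n, forall i, mu i = lam (s i).
Proof.
move=> Mlam; rewrite /has_spectrum Mlam => eq_prod.
have /tuple_permP[s Es] : perm_eq [tuple mu i | i < n] [tuple lam i | i < n].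
  apply: prod_XsubC_eq; rewrite !big_tuple.
  by under eq_bigr do rewrite tnth_mktuple;
     under [RHS]eq_bigr do rewrite tnth_mktuple.
exists s => i; have /(congr1 (fun t => tnth t i)) : 
    [tuple mu i | i < n] = [tuple tnth [tuple lam i | i < n] (s i)  | i < n].
  exact: val_inj.
by rewrite !tnth_mktuple.
Qed.

Lemma sum_sqr_row_unitary n (U : 'M[C]_n) i :
  U \is unitarymx -> \sum_j `|U i j| ^+ 2 = 1.
Proof.
move=> /unitarymxP /matrixP /(_ i i); rewrite !mxE eqxx mulr1n => <-.
by apply: eq_bigr => j _; rewrite !mxE normCK.
Qed.

Lemma sum_sqr_col_unitary n (U : 'M[C]_n) j :
  U \is unitarymx -> \sum_i `|U i j| ^+ 2 = 1.
Proof.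
rewrite -trmx_unitary => /(sum_sqr_row_unitary j) <-.
by apply: eq_bigr => i _; rewrite mxE.
Qed.

Lemma normalmx_diagonalization n (A : 'M[C]_n) : A \is normalmx ->
  exists P d, [/\ P \is unitarymx, P *m A = diag_mx d *m P
                & has_spectrum A (d 0)].
Proof.
move=> An; have /orthomx_spectralP eA := An; have PU := spectral_unitarymx A.
exists (spectralmx A), (spectral_diag A); split=> //.
  by rewrite {2}eA !mulmxA mulmxV ?spectral_unit // mul1mx.
rewrite /has_spectrum {1}eA char_poly_conj ?mulVmx ?spectral_unit //.
rewrite char_poly_trig ?diag_mx_is_trig //.
by apply: eq_bigr => i _; rewrite mxE eqxx.
Qed.

(** With P A = diag(a) P, Q B = diag(b) Q and W = P Q*, unitary invariance gives
    |A - B|_F = |diag(a) W - W diag(b)|_F, whose entries are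
    (a_i - b_j) W_ij; the squared moduli of the entries of the unitary W form a
    doubly stochastic matrix. *)
Theorem hoffman_wielandt n (A B : 'M[C]_n) (lam mu : 'I_n -> C) :
  A \is normalmx -> B \is normalmx -> has_spectrum A lam -> has_spectrum B mu ->
  exists s : 'S_n, \sum_i `|mu (s i) - lam i| ^+ 2 <= fronorm (A - B) ^+ 2.
Proof.
move=> /normalmx_diagonalization[P [a [PU PA Aa]]].
move=> /normalmx_diagonalization[Q [b [QU QB Bb]]] Alam Bmu.
pose W := P *m Q ^t*; have WU : W \is unitarymx.
  by rewrite mul_unitarymx ?trmxC_unitary.
have -> : fronorm (A - B) ^+ 2 =
    \sum_i \sum_j `|W i j| ^+ 2 * `|b 0 j - a 0 i| ^+ 2.
  have QCU : Q ^t* \is unitarymx by rewrite trmxC_unitary.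
  rewrite -(fronorm_mul_unitarymx _ PU) -(fronorm_mulmx_unitary _ QCU).
  have -> : P *m (A - B) *m Q ^t* = diag_mx a *m W - W *m diag_mx b.
    rewrite mulmxBr mulmxBl PA mulmxA; congr (_ - _).
    rewrite /W -!mulmxA; congr (P *m _).
    by rewrite -[B *m _]mul1mx -(mulmx1C (unitarymxP QU)) -mulmxA (mulmxA Q) QB
       -(mulmxA (diag_mx b)) (unitarymxP QU) mulmx1.
  rewrite sqr_fronorm; apply: eq_bigr => i _; apply: eq_bigr => j _.
  rewrite mul_diag_mx mul_mx_diag !mxE -exprMn -normrM mulrBr distrC.
  by rewrite [a 0 i * _]mulrC.
have [||||s sP] := assignment_le_doubly_stochastic
  (c := fun i j => `|b 0 j - a 0 i| ^+ 2) (W := fun i j => `|W i j| ^+ 2).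
- by move=> i j; rewrite realX ?normr_real.
- by move=> i j; rewrite exprn_ge0.
- by move=> i; apply: sum_sqr_row_unitary.
- by move=> i; apply: sum_sqr_col_unitary.
have [sa aE] := has_spectrum_perm Aa Alam.
have [sb bE] := has_spectrum_perm Bb Bmu.
(* The assignment relates the diagonal entries a and b; it is transported to
   the given enumerations lam = a o sa and mu = b o sb of the two spectra. *)
exists (sa * s * sb^-1)%g; apply: le_trans sP.
rewrite [X in _ <= X](reindex_inj (@perm_inj _ sa)) /=.
by under eq_bigr do rewrite bE aE !permM permKV.
Qed.
End HoffmanWielandt.

(** * Entries of a normal matrix above and below the diagonal *)

Section EntrySelection.
Variable C : numClosedFieldType.
Variable n : nat.
Implicit Types (M N A : 'M[C]_n) (P Q : rel 'I_n).

Definition maskmx P M : 'M[C]_n := \matrix_(i, j) (if P i j then M i j else 0).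

Lemma maskmxD P M N : maskmx P (M + N) = maskmx P M + maskmx P N.
Proof. by apply/matrixP => i j; rewrite !mxE; case: ifP; rewrite ?addr0. Qed.

Lemma sqr_fronorm_maskmx P M :
  fronorm (maskmx P M) ^+ 2 = \sum_i \sum_(j | P i j) `|M i j| ^+ 2.
Proof.
rewrite sqr_fronorm; apply: eq_bigr => i _; rewrite [RHS]big_mkcond.
apply: eq_bigr => j _; rewrite !mxE.
by case: (P i j); rewrite ?normr0 ?expr0n.
Qed.

Lemma fronorm_triangle M N : fronorm (M + N) <= fronorm M + fronorm N.
Proof.
have dotE (X : 'M[C]_n) : sqrtC (dotmx (mxvec X) (mxvec X)) = fronorm X.
  rewrite dotmxE mxE /fronorm; congr sqrtC.
  rewrite pair_bigA /= (reindex _ (curry_mxvec_bij n n)) /=.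
  apply: eq_bigr => -[i j] _ /=.
  by rewrite !mxE mxvecE normCK.
by rewrite -!dotE linearD; apply: (triangle_lerif (@dotmx C (n * n))).
Qed.

Lemma fronorm_opp M : fronorm (- M) = fronorm M.
Proof.
congr sqrtC; apply: eq_bigr => i _; apply: eq_bigr => j _.
by rewrite mxE normrN.
Qed.

(** Cauchy-Schwarz for the diagonal of M and the vector of ones. *)
Lemma sqr_norm_trace_le M : `|\tr M| ^+ 2 <= n%:R * \sum_i `|M i i| ^+ 2.
Proof.
have [+ _] := CauchySchwarz (@dotmx C n) (const_mx 1) (\row_i (M i i)^*).
rewrite /= !dotmxE !mxE.
have -> : \sum_j (const_mx 1 : 'rV[C]_n) 0 j * ((\row_i (M i i)^*) ^t*) j 0 = \tr M.
  by apply: eq_bigr => i _; rewrite !mxE conjCK mul1r.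
congr (_ <= _ * _).
  rewrite (eq_bigr (fun=> 1)) ?sumr_const ?card_ord // => i _.
  by rewrite !mxE conjC1 mulr1.
by apply: eq_bigr => i _; rewrite !mxE conjCK normCK mulrC.
Qed.

Section Normal.
Variable A : 'M[C]_n.
Hypothesis An : A \is normalmx.

(** The two sides are the i-th diagonal entries of A A* and A* A. *)
Lemma normalmx_row_col i : \sum_j `|A i j| ^+ 2 = \sum_j `|A j i| ^+ 2.
Proof.
have /normalmxP /matrixP /(_ i i) := An; rewrite !mxE => E.
transitivity (\sum_j A i j * A ^t* j i).
  by apply: eq_bigr => j _; rewrite !mxE normCK.
rewrite E; apply: eq_bigr => j _.
by rewrite !mxE mulrC normCK.
Qed.

(** Summing [normalmx_row_col] over the first k indices, the leading k by k
    block contributes the same amount to both sides. *)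
Lemma normalmx_cut (k : nat) :
  \sum_(i : 'I_n | (i < k)%N) \sum_(j : 'I_n | (k <= j)%N) `|A i j| ^+ 2 =
  \sum_(i : 'I_n | (i < k)%N) \sum_(j : 'I_n | (k <= j)%N) `|A j i| ^+ 2.
Proof.
pose S (F : 'I_n -> 'I_n -> C) := \sum_(i : 'I_n | (i < k)%N) \sum_(j : 'I_n | (j < k)%N) F i j.
have split_rows (F : 'I_n -> 'I_n -> C) :
    \sum_(i : 'I_n | (i < k)%N) \sum_(j : 'I_n | (k <= j)%N) F i j =
    \sum_(i : 'I_n | (i < k)%N) \sum_j F i j - S F.
  rewrite -sumrB; apply: eq_bigr => i _.
  rewrite [in RHS](bigID (fun j : 'I_n => (j < k)%N)) /= addrAC subrr add0r.
  by apply: eq_bigl => j; rewrite leqNgt.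
rewrite (split_rows (fun i j => `|A i j| ^+ 2)).
rewrite (split_rows (fun i j => `|A j i| ^+ 2)).
congr (_ - _); first by apply: eq_bigr => i _; exact: normalmx_row_col.
by rewrite /S exchange_big.
Qed.

(** [K] is the set of indices that are not the first one of their block.  For
    i < j in a common block, j is in K and the cut at j separates i from j;
    so the cuts in K see each such entry at least once, while each of them sees
    a strictly lower entry at most once. *)
Lemma normalmx_same_block_upper_le (T : eqType) (b : 'I_n -> T)
    (K := [set k : 'I_n | [exists i : 'I_n, (i < k)%N && (b i == b k)]]) :
  fronorm (maskmx (fun i j => (i < j)%N && (b i == b j)) A) ^+ 2 <=
  #|K|%:R * fronorm (maskmx (fun i j => (j < i)%N) A) ^+ 2.
Proof.
pose F i j := `|A i j| ^+ 2; have F0 i j : 0 <= F i j by exact: exprn_ge0.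
apply: (@le_trans _ _ (\sum_(k in K) \sum_(i : 'I_n | (i < k)%N)
                          \sum_(j : 'I_n | (k <= j)%N) F i j)).
  rewrite sqr_fronorm_maskmx pair_big_dep /=.
  rewrite (eq_bigr (fun k : 'I_n => \sum_(ij : 'I_n * 'I_n | (ij.1 < k <= ij.2)%N)
      F ij.1 ij.2)); last by move=> k _; rewrite pair_big_dep.
  rewrite (exchange_big_dep xpredT) //= big_mkcond /=.
  apply: ler_sum => -[i j] _ /=; case: ifP => [/andP[ij bij]|_].
    rewrite (bigD1 j) /=; last first.
      by rewrite ij leqnn inE !andbT; apply/existsP; exists i; rewrite ij.
    by rewrite lerDl sumr_ge0.
  by apply: sumr_ge0.
under eq_bigr do rewrite /F normalmx_cut.
rewrite -sum1_card natr_sum mulr_suml; apply: ler_sum => k _; rewrite mul1r.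
rewrite exchange_big /= sqr_fronorm_maskmx pair_big_dep [X in _ <= X]pair_big_dep.
rewrite big_mkcond [X in _ <= X]big_mkcond; apply: ler_sum => -[i j] _ /=.
case: ifP => [/andP[ki jk]|_]; first by rewrite (leq_trans jk ki).
by case: ifP => // _; exact: exprn_ge0.
Qed.

End Normal.

(** The first indices of the blocks meet every block. *)
Lemma card_non_first (T : finType) (b : 'I_n -> T) :
  (forall t, exists i, b i = t) ->
  (#|[set k : 'I_n | [exists i : 'I_n, (i < k)%N && (b i == b k)]]| + #|T| <= n)%N.
Proof.
set K := [set k | _] => bsurj.
rewrite -[X in (_ <= X)%N]card_ord -(cardsC K) leq_add2l -cardsT.
suff -> : setT = b @: ~: K by exact: leq_imset_card.
apply/esym/setP => t; rewrite !inE; have [i bi] := bsurj t.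
case: (arg_minnP (P := fun i => b i == t) (@nat_of_ord n) (i0 := i)) => [|m /eqP bm mmin].
  by rewrite bi.
apply/imsetP; exists m => //; rewrite !inE; apply/existsP => -[j /andP[jm]].
by rewrite bm => /mmin; rewrite leqNgt jm.
Qed.

End EntrySelection.

(** * The three scalar inequalities *)

Section ScalarBounds.
(* Here x, y, d stand for the norms of A_P, E_P and Delta = A_P + E_P, l for the
   norm of the strictly lower part of E, e for delta(E), and k for n - s. *)
Variable C : numClosedFieldType.
Variables (k : nat) (x y d l e : C).
Hypotheses (x0 : 0 <= x) (y0 : 0 <= y) (d0 : 0 <= d) (l0 : 0 <= l) (e0 : 0 <= e).
Hypotheses (xl : x ^+ 2 <= k%:R * l ^+ 2) (lye : l ^+ 2 + y ^+ 2 <= e ^+ 2).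
Hypotheses (xyd : x <= y + d) (yxd : y <= x + d) (dxy : d <= x + y).

Let k0 : 0 <= k%:R :> C. Proof. exact: ler0n. Qed.
Let sk0 : 0 <= sqrtC k%:R :> C. Proof. by rewrite sqrtC_ge0. Qed.

Let x_le : x <= sqrtC k%:R * l.
Proof. by rewrite -(ler_pXn2r (n := 2)) ?nnegrE ?mulr_ge0 // exprMn sqrtCK. Qed.

Let l_le : l <= e.
Proof.
rewrite -(ler_pXn2r (n := 2)) ?nnegrE //; apply: le_trans lye.
by rewrite lerDl exprn_ge0.
Qed.

Lemma sqr_diff_le_sqr : x ^+ 2 - y ^+ 2 <= k%:R * e ^+ 2.
Proof.
rewrite lerBlDr; apply: le_trans xl _; apply: ler_wpDr; first exact: exprn_ge0.
by apply: ler_wpM2l => //; rewrite ler_pXn2r ?nnegrE.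
Qed.

(** x^2 - y^2 = (x - y)(x + y) with x - y <= d, and Cauchy-Schwarz in the plane
    bounds x + y <= sqrt k l + y by sqrt (k + 1) sqrt (l^2 + y^2). *)
Lemma sqr_diff_le_cross : x ^+ 2 - y ^+ 2 <= sqrtC (k%:R + 1) * e * d.
Proof.
have xy_le : x + y <= sqrtC (k%:R + 1) * e.
  rewrite -(ler_pXn2r (n := 2)) ?nnegrE ?addr_ge0 ?mulr_ge0 ?sqrtC_ge0 ?addr_ge0 //.
  rewrite exprMn sqrtCK.
  apply: (@le_trans _ _ ((k%:R + 1) * (l ^+ 2 + y ^+ 2))); last first.
    by apply: ler_wpM2l => //; rewrite addr_ge0.
  apply: (@le_trans _ _ ((sqrtC k%:R * l + y) ^+ 2)).
    by rewrite ler_pXn2r ?nnegrE ?addr_ge0 ?mulr_ge0 // lerD2r.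
  rewrite -subr_ge0; have -> : (k%:R + 1) * (l ^+ 2 + y ^+ 2) -
      (sqrtC k%:R * l + y) ^+ 2 = (sqrtC k%:R * y - l) ^+ 2.
    by rewrite -{1}[k%:R]sqrtCK; ring.
  by rewrite real_exprn_even_ge0 // realB ?ger0_real ?mulr_ge0.
rewrite subr_sqr mulrC; apply: (@le_trans _ _ ((x + y) * d)).
  by apply: ler_wpM2l; [exact: addr_ge0 | rewrite lerBlDl].
by apply: ler_wpM2r.
Qed.

(** Squaring |d - x| <= y gives x^2 - y^2 <= 2 x d - d^2. *)
Lemma sqr_diff_le_completed : x ^+ 2 - y ^+ 2 <= 2 * sqrtC k%:R * e * d - d ^+ 2.
Proof.
have dxy2 : (d - x) ^+ 2 <= y ^+ 2.
  rewrite -real_normK ?realB ?ger0_real // ler_pXn2r ?nnegrE //.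
  by rewrite real_ler_distl ?realB ?ger0_real // lerBlDr dxy andbT addrC.
rewrite lerBrDr addrAC lerBlDr; apply: le_trans (_ : 2 * x * d + y ^+ 2 <= _).
  rewrite -lerBlDl; apply: le_trans dxy2.
    by rewrite le_eqVlt; apply/orP; left; apply/eqP; ring.
rewrite lerD2r ler_wpM2r // -mulrA ler_wpM2l //.
by apply: le_trans x_le _; apply: ler_wpM2l.
Qed.
End ScalarBounds.

(** * Block triangular perturbations of a normal matrix *)

Section BlockTriangular.
Variable C : numClosedFieldType.

(** The subtracted trace term is at most the squared norm of the diagonal, so
    delta dominates everything off the diagonal. *)
Lemma sqr_delta_ge n (M : 'M[C]_n) (P Q : rel 'I_n) :
  (forall i j, P i j -> i != j) -> (forall i j, Q i j -> i != j) ->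
  (forall i j, P i j -> ~~ Q i j) ->
  fronorm (maskmx P M) ^+ 2 + fronorm (maskmx Q M) ^+ 2 <= delta M ^+ 2.
Proof.
move=> Pd Qd PQ; rewrite [delta M ^+ 2]sqrtCK lerBrDr.
have trM : n%:R^-1 * `|\tr M| ^+ 2 <= \sum_i `|M i i| ^+ 2.
  case: n M {P Q Pd Qd PQ} => [|n] M; first by rewrite invr0 mul0r big_ord0.
  by rewrite ler_pdivrMl ?ltr0Sn // sqr_norm_trace_le.
apply: (@le_trans _ _ (fronorm (maskmx P M) ^+ 2 + fronorm (maskmx Q M) ^+ 2 +
  \sum_i `|M i i| ^+ 2)); first by rewrite lerD2l.
rewrite !sqr_fronorm -!big_split /=; apply: ler_sum => i _.
rewrite [X in _ <= X](bigD1 i) //= addrC lerD2l.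
rewrite (bigD1 i) //= [X in X + _ + _](_ : _ = 0); last first.
  by rewrite mxE; case: ifP => [/Pd/eqP//|_]; rewrite normr0 expr0n.
rewrite add0r [X in _ + X](bigD1 i) //= [X in _ + (X + _)](_ : _ = 0); last first.
  by rewrite mxE; case: ifP => [/Qd/eqP//|_]; rewrite normr0 expr0n.
rewrite add0r -big_split /=; apply: ler_sum => j _; rewrite !mxE.
case: ifP => [/PQ/negPf->|_]; first by rewrite normr0 expr0n addr0.
rewrite normr0 expr0n add0r; case: ifP => // _.
by rewrite normr0 expr0n exprn_ge0.
Qed.

(** As [sqrtC] of a negative number is imaginary, this contains the nonnegativity
    of the quantity under the root. *)
Lemma delta_ge0 n (M : 'M[C]_n) : 0 <= delta M.
Proof.
rewrite sqrtC_ge0 -[X in 0 <= X]sqrtCK -/(delta M).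
apply: (@le_trans _ _ (fronorm (maskmx (fun _ _ => false) M) ^+ 2 +
                       fronorm (maskmx (fun _ _ => false) M) ^+ 2)).
  by rewrite addr_ge0 // exprn_ge0 // fronorm_ge0.
exact: sqr_delta_ge.
Qed.

Lemma eig_dist_le n (lamt lam : 'I_n -> C) (pi : 'S_n) (x : C) :
  \sum_i `|lamt (pi i) - lam i| ^+ 2 <= x -> eig_dist lamt lam pi <= sqrtC x.
Proof.
have S0 : 0 <= \sum_i `|lamt (pi i) - lam i| ^+ 2.
  by apply: sumr_ge0 => i _; exact: exprn_ge0.
by move=> Sx; rewrite /eig_dist ler_sqrtC ?nnegrE // (le_trans S0).
Qed.

(** Off the pairs in P, A agrees with the diagonal of T up to the entries of E;
    on P, the diagonal matrix vanishes and E is traded for A. *)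
Lemma sqr_fronorm_diag_dist n (A E T : 'M[C]_n) (P : rel 'I_n) :
  T = A + E -> (forall i j, P i j -> i != j) ->
  (forall i j, i != j -> ~~ P i j -> T i j = 0) ->
  fronorm (A - diag_mx (\row_i T i i)) ^+ 2 =
  fronorm E ^+ 2 + (fronorm (maskmx P A) ^+ 2 - fronorm (maskmx P E) ^+ 2).
Proof.
move=> TAE Pd T0; rewrite !sqr_fronorm -sumrB -big_split; apply: eq_bigr => i _.
rewrite /= -sumrB -big_split; apply: eq_bigr => j _ /=; rewrite !mxE.
have [Pij|nPij] := boolP (P i j).
  by rewrite (negPf (Pd _ _ Pij)) subr0 addrC subrK.
rewrite normr0 expr0n subrr addr0; have [<-|ij] := eqVneq i j.
  by rewrite TAE mxE mulr1n opprD addrA subrr add0r normrN.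
have := T0 _ _ ij nPij; rewrite TAE mxE => /eqP; rewrite addr_eq0 => /eqP ->.
by rewrite subr0 normrN.
Qed.

(** Surjectivity of the labelling [b] is what bounds the number of indices not
    first in their block by n - s. *)
Theorem block_triangular_eig_dist n s (A E T : 'M[C]_n) (b : 'I_n -> 'I_s)
    (lam lamt : 'I_n -> C) :
  A \is normalmx -> T = A + E -> upper_triangular T ->
  (forall i j, b i != b j -> T i j = 0) -> (forall k, exists i, b i = k) ->
  has_spectrum A lam -> has_spectrum T lamt ->
  exists pi : 'S_n,
    let D2 := eig_dist lamt lam pi in
    let Delta := strict_upper T in
    [/\ D2 <= sqrtC (fronorm E ^+ 2 + (n%:R - s%:R) * delta E ^+ 2),
        D2 <= sqrtC (fronorm E ^+ 2
                     + sqrtC (n%:R - s%:R + 1) * delta E * fronorm Delta)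
      & D2 <= sqrtC (fronorm E ^+ 2
                     + 2 * sqrtC (n%:R - s%:R) * delta E * fronorm Delta
                     - fronorm Delta ^+ 2)].
Proof.
move=> An TAE Tup Tb bsurj Alam Tlamt.
pose P (i j : 'I_n) := (i < j)%N && (b i == b j).
pose L (i j : 'I_n) := (j < i)%N.
have Pd i j : P i j -> i != j.
  by move=> /andP[ij _]; apply: contraTneq ij => ->; rewrite ltnn.
have Ld i j : L i j -> i != j.
  by move=> ij; apply: contraTneq ij => ->; rewrite /L ltnn.
have T0 i j : i != j -> ~~ P i j -> T i j = 0.
  rewrite negb_and -leqNgt => ij /orP[ji|/Tb//].
  by apply: Tup; rewrite ltn_neqAle ji eq_sym ij.
pose D := diag_mx (\row_i T i i).
have Dn : D \is normalmx.
  apply/normalmxP; rewrite /D tr_diag_mx map_diag_mx; exact: diag_mxC.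
have Dlamt : has_spectrum D lamt.
  rewrite /has_spectrum -Tlamt (char_poly_upper_triangular Tup).
  rewrite char_poly_trig ?diag_mx_is_trig //.
  by apply: eq_bigr => i _; rewrite !mxE eqxx.
have [pi piP] := hoffman_wielandt An Dn Alam Dlamt.
rewrite (sqr_fronorm_diag_dist TAE Pd T0) in piP.
have DeltaE : strict_upper T = maskmx P A + maskmx P E.
  rewrite -maskmxD -TAE; apply/matrixP => i j; rewrite !mxE /P.
  by case: ltnP => //= _; have [//|/Tb] := eqVneq (b i) (b j).
have card_le := card_non_first bsurj; rewrite card_ord in card_le.
have sn : (s <= n)%N by apply: leq_trans card_le; exact: leq_addl.
have upper_le : fronorm (maskmx P A) ^+ 2 <=
    (n - s)%:R * fronorm (maskmx L E) ^+ 2.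
  have -> : fronorm (maskmx L E) ^+ 2 = fronorm (maskmx L A) ^+ 2.
    rewrite !sqr_fronorm_maskmx; apply: eq_bigr => i _; apply: eq_bigr => j ji.
    have := Tup _ _ ji; rewrite TAE mxE => /eqP; rewrite addr_eq0 => /eqP ->.
    by rewrite normrN.
  apply: le_trans (normalmx_same_block_upper_le An b) _.
  by rewrite ler_wpM2r ?exprn_ge0 ?fronorm_ge0 // ler_nat leq_subRL // addnC.
have delta_le : fronorm (maskmx L E) ^+ 2 + fronorm (maskmx P E) ^+ 2 <=
    delta E ^+ 2.
  by apply: sqr_delta_ge => // i j ji; rewrite /P negb_and -leqNgt ltnW.
have PAE : maskmx P A = strict_upper T + - maskmx P E by rewrite DeltaE addrK.
have PEA : maskmx P E = strict_upper T + - maskmx P A.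
  by rewrite DeltaE addrC addKr.
have tA : fronorm (maskmx P A) <= fronorm (maskmx P E) + fronorm (strict_upper T).
  by rewrite {1}PAE addrC -(fronorm_opp (maskmx P E)); apply: fronorm_triangle.
have tE : fronorm (maskmx P E) <= fronorm (maskmx P A) + fronorm (strict_upper T).
  by rewrite {1}PEA addrC -(fronorm_opp (maskmx P A)); apply: fronorm_triangle.
have tD : fronorm (strict_upper T) <= fronorm (maskmx P A) + fronorm (maskmx P E).
  by rewrite DeltaE; apply: fronorm_triangle.
have fge0 X : 0 <= fronorm (X : 'M[C]_n) by exact: fronorm_ge0.
have dge0 : 0 <= delta E by exact: delta_ge0.
exists pi; rewrite /= -natrB //.
split; apply: eig_dist_le; apply: le_trans piP _; rewrite -?addrA lerD2l.
- exact: (sqr_diff_le_sqr (l := fronorm (maskmx L E))).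
- exact: (sqr_diff_le_cross (l := fronorm (maskmx L E))).
- exact: (sqr_diff_le_completed (l := fronorm (maskmx L E))).
Qed.

Lemma delta_conj_unitary n (M U : 'M[C]_n) :
  U \is unitarymx -> delta (U ^t* *m M *m U) = delta M.
Proof.
move=> UU; have UCU : U ^t* \is unitarymx by rewrite trmxC_unitary.
rewrite /delta fronorm_mulmx_unitary // fronorm_mul_unitarymx //.
by rewrite mxtrace_mulC mulmxA (unitarymxP UU) mul1mx.
Qed.

Lemma normalmx_conj_unitary n (M U : 'M[C]_n) :
  M \is normalmx -> U \is unitarymx -> U ^t* *m M *m U \is normalmx.
Proof.
move=> /normalmxP Mn UU; apply/normalmxP.
rewrite !trmx_mul !map_mxM /= trmxCK !mulmxA.
by rewrite !(mulmxtVK _ UU) -(mulmxA _ M) Mn mulmxA.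
Qed.

End BlockTriangular.

(** * Labelling the indices of a block diagonal matrix *)

Section BlockIndex.
Variables (V : nmodType) (s : nat) (p : 'I_s -> nat).

Lemma sig1_surjective : (forall k, (0 < p k)%N) ->
  forall k, exists i, @tagnat.sig1 s p i = k.
Proof. by move=> p0 k; exists (tagnat.Rank k (Ordinal (p0 k))); rewrite tagnat.Rank1K. Qed.

Lemma mxdiag_neq_block (B : forall k, 'M[V]_(p k)) i j :
  tagnat.sig1 i != tagnat.sig1 j -> (\mxdiag_k B k) i j = 0.
Proof. by move=> /negPf ij; rewrite mxE ij mxE. Qed.
End BlockIndex.

Lemma mxdiag_upper_triangular (C : numClosedFieldType) s (p : 'I_s -> nat)
    (B : forall k, 'M[C]_(p k)) :
  (forall k, upper_triangular (B k)) -> upper_triangular (\mxdiag_k B k).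
Proof.
move=> Bup i j ji; rewrite mxE; case: eqP => [eij|_]; last by rewrite mxE.
have vu : (tagnat.sig2 j < tagnat.sig2 i)%N.
  move: ji; rewrite (tagnat.rect i) (tagnat.rect j).
  rewrite (_ : \sum_(k < s | (k < tagnat.sig1 i)%N) p k =
               \sum_(k < s | (k < tagnat.sig1 j)%N) p k)%N.
    by rewrite ltn_add2l.
  by rewrite eij.
(* The off-diagonal zero blocks have rectangular types; identifying the two
   block labels makes the block square, so that [conform_mx] returns it. *)
move: eij (tagnat.sig2 i) (tagnat.sig2 j) vu => /= <- u v vu.
by rewrite conform_mx_id Bup.
Qed.

(** * Unitary reduction to the block triangular case *)

Theorem theorem3p10 (R : realType) (n : nat) (A E At : 'M[R[i]]_n)
  (hA : A \is normalmx)
  (hAt : At = A + E)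
  (s : nat) (hs : (0 < s)%N)
  (p : 'I_s -> nat) (hp : forall k : 'I_s, (0 < p k)%N)
  (hn : (\sum_(k < s) p k)%N = n)
  (B : forall k : 'I_s, 'M[R[i]]_(p k))
  (hB : forall k : 'I_s, upper_triangular (B k))
  (U : 'M[R[i]]_n) (hU : U \is unitarymx)
  (hdec : At = U *m castmx (hn, hn) (\mxdiag_(k < s) B k) *m U ^t*)
  (lam lamt : 'I_n -> R[i])
  (hlam : has_spectrum A lam)
  (hlamt : has_spectrum At lamt) :
  let Delta1 := strict_upper (U ^t* *m At *m U) in
  exists pi : 'S_n,
    let D2 := eig_dist lamt lam pi in
    [/\ D2 <= sqrtC (fronorm E ^+ 2 + (n%:R - s%:R) * delta E ^+ 2),
        D2 <= sqrtC (fronorm E ^+ 2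
                     + sqrtC (n%:R - s%:R + 1) * delta E * fronorm Delta1)
      & D2 <= sqrtC (fronorm E ^+ 2
                     + 2 * sqrtC (n%:R - s%:R) * delta E * fronorm Delta1
                     - fronorm Delta1 ^+ 2)].
Proof.
have UCU : U ^t* \is unitarymx by rewrite trmxC_unitary.
set T := U ^t* *m At *m U.
have TE : T = castmx (hn, hn) (\mxdiag_(k < s) B k).
  rewrite /T hdec !mulmxA (mulmx1C (unitarymxP hU)) mul1mx.
  by rewrite -mulmxA (mulmx1C (unitarymxP hU)) mulmx1.
have castE i j : T i j =
    (\mxdiag_(k < s) B k) (cast_ord (esym hn) i) (cast_ord (esym hn) j).
  by rewrite TE castmxE.
have spec M mu : has_spectrum M mu -> has_spectrum (U ^t* *m M *m U) mu.
  rewrite /has_spectrum => <-; apply: char_poly_conj; exact: (mulmx1C (unitarymxP hU)).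
have [] := @block_triangular_eig_dist _ n s (U ^t* *m A *m U) (U ^t* *m E *m U)
  T (fun i => tagnat.sig1 (cast_ord (esym hn) i)) lam lamt.
- exact: normalmx_conj_unitary.
- by rewrite /T hAt mulmxDr mulmxDl.
- by move=> i j ji; rewrite castE; apply: mxdiag_upper_triangular.
- by move=> i j ij; rewrite castE; apply: mxdiag_neq_block.
- move=> k; have [i <-] := sig1_surjective hp k.
  by exists (cast_ord hn i); rewrite cast_ordK.
- exact: spec.
- exact: spec.
move=> pi piP; exists pi; move: piP.
by rewrite delta_conj_unitary // fronorm_mulmx_unitary // fronorm_mul_unitarymx.
Qed.
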